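(* Let $n\ge1$ and $k\in\{0,1,\dots,n-1\}$. For every real $n\times n$ matrix $A=(A_{ij})$ (not necessarily symmetric), \[ S_{k+1}^{ij}(A)=S_k(A)\,\delta_{ij}-\sum_{l=1}^nS_k^{il}(A)\,A_{jl}\qquad\text{for all } i,j=1,\dots,n. \]
   Context: For an $n\times n$ real matrix $A$, $S_k(A)=\frac1{k!}\sum_{1\le i_1,\dots,i_k,j_1,\dots,j_k\le n}\delta_{i_1\cdots i_k}^{j_1\cdots j_k}A_{i_1j_1}\cdots A_{i_kj_k}$ is the sum of its principal $k\times k$ minors, where $\delta_{i_1\cdots i_k}^{j_1\cdots j_k}$ is $+1$ (resp. $-1$) if $i_1,\dots,i_k$ are distinct and $(j_1,\dots,j_k)$ is an even (resp. odd) permutation of $(i_1,\dots,i_k)$, and $0$ otherwise; $S_0(A)=1$. $S_k^{ij}(A)=\partial S_k(A)/\partial A_{ij}$ (with the $n^2$ entries regarded as independent variables; so $S_0^{ij}=0$, $S_1^{ij}=\delta_{ij}$). $\delta_{ij}$ is the usual Kronecker delta. *)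

(* Defs.v *)
From mathcomp Require Import all_boot all_order all_algebra all_fingroup.
From mathcomp Require Import all_classical all_reals all_analysis.
Import Order.TTheory GRing.Theory Num.Theory.
Import numFieldNormedType.Exports.

Set Implicit Arguments.
Unset Strict Implicit.
Unset Printing Implicit Defensive.

Local Open Scope ring_scope.

(* The generalized Kronecker delta, with lower indices i and upper indices j.
   When i is injective there is at most one s with j t = i (s t) for all t, so
   the result does not depend on the permutation picked. *)
Definition gkronecker (R : realType) (n k : nat)
    (i j : {ffun 'I_k -> 'I_n}) : R :=
  if injectiveb i then
    if [pick s : 'S_k | [forall t : 'I_k, j t == i (s t)]] is Some s
    then (-1) ^+ odd_perm s else 0
  else 0.

Definition Sk (R : realType) (n k : nat) (A : 'M[R]_n) : R :=
  (k`!%:R)^-1 *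
  \sum_(i : {ffun 'I_k -> 'I_n}) \sum_(j : {ffun 'I_k -> 'I_n})
    gkronecker R i j * \prod_(t < k) A (i t) (j t).

(* The derivative at A along the elementary matrix E_ij is the partial
   derivative with respect to the entry A_ij.  The operator 'D is total; the
   limit it takes always exists here, by Sk_derivable. *)
Definition dSk (R : realType) (n k : nat) (i j : 'I_n) (A : 'M[R]_n) : R :=
  'D_(delta_mx i j) (@Sk R n k) A.

Lemma Sk0 (R : realType) (n : nat) (A : 'M[R]_n) : Sk 0 A = 1.
Proof.
rewrite /Sk fact0 invr1 mul1r.
have E (F : {ffun 'I_0 -> 'I_n} -> R) :
    \sum_f F f = F [ffun x : 'I_0 => False_rect _ (notF (ltn_ord x))].
  rewrite (bigD1 [ffun x : 'I_0 => False_rect _ (notF (ltn_ord x))]) //=.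
  rewrite big1 ?addr0 // => f /eqP[]; by apply/ffunP => -[].
rewrite !E big_ord0 mulr1 /gkronecker ifT; last by apply/injectiveP => -[].
case: pickP => [s _|/(_ 1%g)]; first by rewrite [s](_ : _ = 1%g) ?odd_perm1 //; apply/permP => -[].
by move/negbT/negP; case; apply/forallP => -[].
Qed.

Lemma derivable_entry (R : realType) (n : nat) (a b : 'I_n) (A V : 'M[R]_n) :
  derivable (fun M : 'M[R]_n => M a b) A V.
Proof.
apply/cvg_ex; exists (V a b); apply: cvg_near_cst.
near=> h; rewrite /= !mxE addrK; apply: mulKf.
by near: h; exact: nbhs_dnbhs_neq.
Unshelve. all: by end_near. Qed.

Lemma Sk_derivable (R : realType) (n k : nat) (A V : 'M[R]_n) :
  derivable (@Sk R n k) A V.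
Proof.
have derivable_bigD (I : Type) (r : seq I) (F : I -> 'M[R]_n -> R) :
    (forall x, derivable (F x) A V) ->
    derivable (fun M => \sum_(x <- r) F x M) A V.
  move=> dF; elim: r => [|x r IHr].
    under eq_fun do rewrite big_nil; exact: derivable_cst.
  under eq_fun do rewrite big_cons; exact: (derivableD (dF x) IHr).
have derivable_bigM (I : Type) (r : seq I) (F : I -> 'M[R]_n -> R) :
    (forall x, derivable (F x) A V) ->
    derivable (fun M => \prod_(x <- r) F x M) A V.
  move=> dF; elim: r => [|x r IHr].
    under eq_fun do rewrite big_nil; exact: derivable_cst.
  under eq_fun do rewrite big_cons; exact: (derivableM (dF x) IHr).
apply: (derivableM (derivable_cst _ _ _)).
apply: (derivable_bigD) => i; apply: derivable_bigD => j.
apply: (derivableM (derivable_cst _ _ _)).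
by apply: derivable_bigM => t; exact: derivable_entry.
Qed.

(* Main.v *)
(* S_k(A) is 1/k! times the sum of det A[f,f] over all f : 'I_k -> 'I_n (the
   non-injective f contribute 0), so S_(k+1)^ij is 1/(k+1)! times the sum over f
   of the (p,q) cofactors of A[f,f] with f p = i and f q = j. Precomposing f with
   a permutation permutes rows and columns simultaneously, so one may take p = 0
   and replace 1/(k+1)! by 1/k!. The terms with q = 0 give S_k(A) delta_ij. For
   those with q > 0 one may, by the same symmetry, take q = 1, which leaves
   - 1/(k-1)! times the sum over h of det A[j::h, i::h]. That sum is also the
   cofactor expansion along the first row of sum_l S_k^il A_jl. *)
Require Import Defs.
From mathcomp Require Import all_boot all_order all_algebra all_fingroup.
From mathcomp Require Import all_classical all_reals all_analysis.
Import Order.TTheory GRing.Theory Num.Theory.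
Import numFieldNormedType.Exports.

Local Open Scope ring_scope.

(** * Cofactors under row replacement and simultaneous row and column permutation *)

Section Cofactors.

Context {R : comNzRingType}.

Lemma cofactor_eq_off_row {n : nat} (M N : 'M[R]_n) (p q : 'I_n) :
  (forall i j, i != p -> M i j = N i j) -> cofactor M p q = cofactor N p q.
Proof.
move=> MN; rewrite /cofactor; congr (_ * \det _).
by apply/matrixP => i j; rewrite !mxE MN // eq_sym neq_lift.
Qed.

Lemma det_row_update {n : nat} (M : 'M[R]_n) (p : 'I_n) (v : 'I_n -> R) :
  \det (\matrix_(i, j) (if i == p then v j else M i j)) =
  \sum_q v q * cofactor M p q.
Proof.
rewrite (expand_det_row _ p); apply: eq_bigr => q _; rewrite mxE eqxx.
congr (_ * _); apply: cofactor_eq_off_row => i j /negPf ip.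
by rewrite mxE ip.
Qed.

(** A full determinant avoids the index shifts of a minor, so the permutation invariance of
    cofactors can be read off from that of determinants. *)
Lemma cofactor_det {n : nat} (M : 'M[R]_n) (p q : 'I_n) :
  cofactor M p q =
  \det (\matrix_(i, j) (if i == p then (j == q)%:R else M i j)).
Proof.
rewrite det_row_update (bigD1 q) //= eqxx mul1r big1 ?addr0 // => j /negPf ->.
by rewrite mul0r.
Qed.

Lemma det_mxsub_perm {n : nat} (s : 'S_n) (M : 'M[R]_n) :
  \det (mxsub s s M) = \det M.
Proof.
have -> : mxsub s s M = row_perm s (col_perm s M).
  by apply/matrixP => i j; rewrite !mxE.
rewrite row_permE col_permE !det_mulmx !det_perm odd_permV mulrCA.
by rewrite -expr2 sqrr_sign mulr1.
Qed.

Lemma cofactor_mxsub_perm {n : nat} (s : 'S_n) (M : 'M[R]_n) (p q : 'I_n) :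
  cofactor (mxsub s s M) p q = cofactor M (s p) (s q).
Proof.
rewrite !cofactor_det -[RHS](det_mxsub_perm s); congr (\det _).
by apply/matrixP => i j; rewrite !mxE !(inj_eq perm_inj).
Qed.

End Cofactors.

(** * Index tuples: splitting off the head, permuting positions *)

Section FfunCons.

Definition fcons {T : Type} {k : nat} (x : T) (g : {ffun 'I_k -> T}) :
    {ffun 'I_k.+1 -> T} := [ffun i => oapp g x (unlift ord0 i)].

Lemma fcons0 {T : Type} {k : nat} (x : T) (g : {ffun 'I_k -> T}) :
  fcons x g ord0 = x.
Proof. by rewrite ffunE unlift_none. Qed.

Lemma fconsS {T : Type} {k : nat} (x : T) (g : {ffun 'I_k -> T}) (i : 'I_k) :
  fcons x g (lift ord0 i) = g i.
Proof. by rewrite ffunE liftK. Qed.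

Lemma sum_fcons {R : nmodType} {T : finType} {k : nat}
    (F : {ffun 'I_k.+1 -> T} -> R) :
  \sum_f F f = \sum_x \sum_g F (fcons x g).
Proof.
rewrite pair_big /=.
rewrite (reindex_onto (fun u : T * {ffun 'I_k -> T} => fcons u.1 u.2)
  (fun f => (f ord0, [ffun i => f (lift ord0 i)]))) /=; last first.
  move=> f _; apply/ffunP => i; rewrite ffunE.
  by case: unliftP => [j|] -> //=; rewrite ffunE.
apply: eq_bigl => -[x g] /=; rewrite fcons0; apply/eqP; congr pair.
by apply/ffunP => i; rewrite ffunE fconsS.
Qed.

Lemma sum_ffun_perm {R : nmodType} {T I : finType} (s : {perm I})
    (F : {ffun I -> T} -> R) :
  \sum_f F f = \sum_(f : {ffun I -> T}) F [ffun i => f (s i)].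
Proof.
apply: reindex_inj => f g /ffunP fg; apply/ffunP => i.
by have := fg (s^-1 i)%g; rewrite !ffunE permKV.
Qed.

End FfunCons.

(** * Sums of cofactors over index tuples *)

Section PrincipalCofactorSums.

Context {R : comNzRingType} {n : nat}.
Implicit Types (A V : 'M[R]_n).

Lemma cofactor_mxsub_ffun_perm {k : nat} (s : 'S_k)
    (f : {ffun 'I_k -> 'I_n}) A (p q : 'I_k) :
  let fs := [ffun i => f (s i)] in
  cofactor (mxsub fs fs A) p q = cofactor (mxsub f f A) (s p) (s q).
Proof.
rewrite /= -cofactor_mxsub_perm; congr (cofactor _ p q).
by apply/matrixP => i j; rewrite !mxE !ffunE.
Qed.

(** Precomposing [f] with the transposition of positions 0 and [p], and relabelling [q] by it, turns
    row [p] into row 0, so all [k.+1] values of [p] contribute equally. *)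
Lemma sum_cofactor_row0 {k : nat} A V :
  \sum_(f : {ffun 'I_k.+1 -> 'I_n}) \sum_p \sum_q
     V (f p) (f q) * cofactor (mxsub f f A) p q =
  (\sum_(f : {ffun 'I_k.+1 -> 'I_n}) \sum_q
     V (f ord0) (f q) * cofactor (mxsub f f A) ord0 q) *+ k.+1.
Proof.
rewrite exchange_big /=; set S := (X in _ = X *+ _).
have <- : \sum_(p < k.+1) S = S *+ k.+1 by rewrite sumr_const card_ord.
apply: eq_bigr => p _; rewrite (sum_ffun_perm (tperm ord0 p)).
apply: eq_bigr => f _; rewrite [RHS](reindex_inj (@perm_inj _ (tperm ord0 p))).
apply: eq_bigr => q _; rewrite cofactor_mxsub_ffun_perm !ffunE tpermR.
by [].
Qed.

(** The transposition of positions 1 and [q + 1] fixes 0, so it brings column [q + 1] to column 1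
    while row 0 stays in place. *)
Lemma sum_cofactor_entry01 {k : nat} A V :
  \sum_(f : {ffun 'I_k.+2 -> 'I_n}) \sum_(q < k.+1)
     V (f ord0) (f (lift ord0 q)) * cofactor (mxsub f f A) ord0 (lift ord0 q) =
  (\sum_(f : {ffun 'I_k.+2 -> 'I_n})
     V (f ord0) (f (lift ord0 ord0)) *
     cofactor (mxsub f f A) ord0 (lift ord0 ord0)) *+ k.+1.
Proof.
rewrite exchange_big /=; set S := (X in _ = X *+ _).
have <- : \sum_(p < k.+1) S = S *+ k.+1 by rewrite sumr_const card_ord.
apply: eq_bigr => q _.
rewrite (sum_ffun_perm (tperm (lift ord0 ord0) (lift ord0 q))).
apply: eq_bigr => f _; rewrite cofactor_mxsub_ffun_perm !ffunE tpermR.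
by rewrite tpermD // eq_sym neq_lift.
Qed.

Lemma cofactor_fcons00 {k : nat} A (a : 'I_n) (g : {ffun 'I_k -> 'I_n}) :
  cofactor (mxsub (fcons a g) (fcons a g) A) ord0 ord0 = \det (mxsub g g A).
Proof.
rewrite /cofactor addn0 expr0 mul1r; congr (\det _).
by apply/matrixP => i j; rewrite !mxE !fconsS.
Qed.

(** Deleting row 0 drops [a] from the row indices, and deleting column 1 drops [b] from the column
    indices; the sign is $(-1)^{0+1}$. *)
Lemma cofactor_fcons01 {k : nat} A (a b : 'I_n) (h : {ffun 'I_k -> 'I_n}) :
  let f := fcons a (fcons b h) in
  cofactor (mxsub f f A) ord0 (lift ord0 ord0) =
  - \det (mxsub (fcons b h) (fcons a h) A).
Proof.
rewrite /= /cofactor /= expr1 mulN1r; congr (- \det _).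
apply/matrixP => i j; rewrite !mxE !fconsS; congr (A _ _).
case: (unliftP ord0 j) => [j'|] ->; last first.
  have -> : lift (lift ord0 ord0) ord0 = ord0 :> 'I_k.+2 by apply/val_inj.
  by rewrite !fcons0.
have -> : lift (lift ord0 ord0) (lift ord0 j') = lift ord0 (lift ord0 j')
   :> 'I_k.+2 by apply/val_inj.
by rewrite !fconsS.
Qed.

(** At [q = 0] the matrix unit is nonzero only if [f ord0 = a = b], and the cofactor is then the
    principal minor of the tail of [f]. *)
Lemma sum_delta_cofactor {k : nat} A (a b : 'I_n) :
  \sum_(f : {ffun 'I_k.+1 -> 'I_n}) \sum_q
     delta_mx a b (f ord0) (f q) * cofactor (mxsub f f A) ord0 q =
  (\sum_(g : {ffun 'I_k -> 'I_n}) \det (mxsub g g A)) * (a == b)%:R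
  + \sum_(f : {ffun 'I_k.+1 -> 'I_n}) \sum_(q < k)
     delta_mx a b (f ord0) (f (lift ord0 q)) *
     cofactor (mxsub f f A) ord0 (lift ord0 q).
Proof.
under eq_bigr do rewrite big_ord_recl.
rewrite big_split /=; congr (_ + _).
rewrite sum_fcons (bigD1 a) //= [X in _ + X]big1 ?addr0; last first.
  move=> c /negPf ca; apply: big1 => g _.
  by rewrite fcons0 mxE ca mul0r.
rewrite mulr_suml; apply: eq_bigr => g _.
by rewrite fcons0 cofactor_fcons00 mxE eqxx /= mulrC.
Qed.

Lemma sum_delta_cofactor01 {k : nat} A (a b : 'I_n) :
  \sum_(f : {ffun 'I_k.+2 -> 'I_n})
     delta_mx a b (f ord0) (f (lift ord0 ord0)) *
     cofactor (mxsub f f A) ord0 (lift ord0 ord0) =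
  - \sum_(h : {ffun 'I_k -> 'I_n}) \det (mxsub (fcons b h) (fcons a h) A).
Proof.
rewrite sum_fcons (bigD1 a) //= [X in _ + X]big1 ?addr0; last first.
  move=> c /negPf ca; apply: big1 => g _.
  by rewrite fcons0 mxE ca mul0r.
rewrite sum_fcons (bigD1 b) //= [X in _ + X]big1 ?addr0; last first.
  move=> c /negPf cb; apply: big1 => g _.
  by rewrite fcons0 fconsS fcons0 mxE cb andbF mul0r.
rewrite -sumrN; apply: eq_bigr => h _.
by rewrite cofactor_fcons01 fcons0 fconsS fcons0 mxE !eqxx mul1r.
Qed.

(** The matrix unit forces [f = fcons a h] and [l = f q]. What remains is the expansion along row 0
    of the submatrix of [fcons a h] with that row taken from row [b] of [A]. *)
Lemma sum_delta_cofactor_row {k : nat} A (a b : 'I_n) :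
  \sum_l (\sum_(f : {ffun 'I_k.+1 -> 'I_n}) \sum_q
     delta_mx a l (f ord0) (f q) * cofactor (mxsub f f A) ord0 q) * A b l =
  \sum_(h : {ffun 'I_k -> 'I_n}) \det (mxsub (fcons b h) (fcons a h) A).
Proof.
under eq_bigr do rewrite mulr_suml.
rewrite exchange_big /= sum_fcons (bigD1 a) //= [X in _ + X]big1 ?addr0; last first.
  move=> c /negPf ca; apply: big1 => g _; apply: big1 => l _.
  by rewrite big1 ?mul0r // => q _; rewrite fcons0 mxE ca mul0r.
apply: eq_bigr => h _; under eq_bigr do rewrite mulr_suml.
rewrite exchange_big /=.
transitivity (\sum_q A b (fcons a h q) *
    cofactor (mxsub (fcons a h) (fcons a h) A) ord0 q).
  apply: eq_bigr => q _; rewrite (bigD1 (fcons a h q)) //= big1 ?addr0.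
    by rewrite fcons0 mxE !eqxx mul1r mulrC.
  by move=> l lq; rewrite mxE [fcons a h q == l]eq_sym (negPf lq) andbF !mul0r.
rewrite -det_row_update; congr (\det _); apply/matrixP => i j; rewrite !mxE.
by case: (unliftP ord0 i) => [i'|] ->; rewrite ?eqxx ?fcons0 // !fconsS.
Qed.

End PrincipalCofactorSums.

(** * Derivatives of finite sums and products *)

Section Derivatives.

Context {R : realType} {V : normedModType R}.

Lemma is_derive_bigsum {I : Type} (r : seq I) (x v : V) (F : I -> V -> R)
    (dF : I -> R) :
  (forall i, is_derive x v (F i) (dF i)) ->
  is_derive x v (fun y => \sum_(i <- r) F i y) (\sum_(i <- r) dF i).
Proof.
move=> dFP; elim: r => [|i r IHr].
  under eq_fun do rewrite big_nil; rewrite big_nil; exact: is_derive_cst.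
under eq_fun do rewrite big_cons; rewrite big_cons.
exact: (is_deriveD (dFP i) IHr).
Qed.

Lemma is_derive_prod_ord {k : nat} (x v : V) (F : 'I_k -> V -> R)
    (dF : 'I_k -> R) :
  (forall i, is_derive x v (F i) (dF i)) ->
  is_derive x v (fun y => \prod_(i < k) F i y)
    (\sum_(p < k) \prod_(i < k) (if i == p then dF i else F i x)).
Proof.
elim: k F dF => [|k IHk] F dF dFP.
  under eq_fun do rewrite big_ord0; rewrite big_ord0; exact: is_derive_cst.
under eq_fun do rewrite big_ord_recl.
have := is_deriveM (dFP ord0) (IHk _ _ (fun i => dFP (lift ord0 i))).
move/is_derive_eq; apply; rewrite big_ord_recl addrC; congr (_ + _).
  by rewrite big_ord_recl eqxx mulrC.
rewrite /GRing.scale /= mulr_sumr; apply: eq_bigr => p _.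
by rewrite big_ord_recl /=; congr (_ * _); apply: eq_bigr.
Qed.

End Derivatives.

(** * Determinantal form of $S_k$ and of its partial derivatives *)

Section DerivativeSk.

Context {R : realType} {n : nat}.
Implicit Types (A V : 'M[R]_n).

Lemma is_derive_entry (a b : 'I_n) A V :
  is_derive A V (fun M : 'M[R]_n => M a b) (V a b).
Proof.
apply: DeriveDef; first exact: derivable_entry.
apply: cvg_lim => //; apply: cvg_near_cst.
near=> h; rewrite /= !mxE addrK; apply: mulKf.
by near: h; exact: nbhs_dnbhs_neq.
Unshelve. all: by end_near. Qed.

(** The product rule is applied to each term of the Leibniz formula: [p] marks the differentiated
    row, which becomes the matching row of [V], and expansion along it gives the cofactors. *)
Lemma is_derive_det_mxsub {k : nat} (f : {ffun 'I_k -> 'I_n}) A V :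
  is_derive A V (fun M => \det (mxsub f f M))
    (\sum_p \sum_q V (f p) (f q) * cofactor (mxsub f f A) p q).
Proof.
have dprod (s : 'S_k) := is_derive_prod_ord A V _ _
  (fun t => is_derive_entry (f t) (f (s t)) A V).
have := is_derive_bigsum (index_enum 'S_k) A V _ _
  (fun s => is_deriveZ ((-1) ^+ s) (dprod s)).
have -> : (fun M : 'M[R]_n => \sum_(s : 'S_k)
    (-1) ^+ s *: \prod_(t < k) M (f t) (f (s t))) =
    (fun M => \det (mxsub f f M)).
  apply/funext => M; apply: eq_bigr => s _; congr (_ * _).
  by apply: eq_bigr => t _; rewrite mxE.
move/is_derive_eq; apply.
under eq_bigr do rewrite /GRing.scale /= mulr_sumr.
rewrite exchange_big /=; apply: eq_bigr => p _.
rewrite -det_row_update; apply: eq_bigr => s _; congr (_ * _).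
by apply: eq_bigr => t _; rewrite !mxE; case: eqP => // ->.
Qed.

(** For injective [f] only the [j] of the form [f] after a permutation contribute, which is the
    Leibniz formula; otherwise the submatrix has two equal rows. *)
Lemma Sk_det (k : nat) A :
  Sk k A = (k`!%:R)^-1 * \sum_(f : {ffun 'I_k -> 'I_n}) \det (mxsub f f A).
Proof.
congr (_ * _); apply: eq_bigr => f _; rewrite /gkronecker.
case: (boolP (injectiveb f)) => [/injectiveP f_inj|/injectivePn[x [y xy fxy]]]; last first.
  rewrite big1 => [|j _]; last by rewrite mul0r.
  by rewrite (determinant_alternate xy) // => z; rewrite !mxE fxy.
pose fs (s : 'S_k) := [ffun t => f (s t)].
have fs_inj : injective fs.
  move=> s s' /ffunP E; apply/permP => t; apply: f_inj.
  by have := E t; rewrite !ffunE.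
(* Injectivity of [f] makes [s] recoverable from [fs s], so the choice in [gkronecker] is forced. *)
have pickE (s : 'S_k) : [pick s' : 'S_k | [forall t, fs s t == f (s' t)]] = Some s.
  case: pickP => [s' /forallP E|/(_ s)/negbT/negP[]].
    by congr Some; apply: fs_inj; apply/ffunP => t; rewrite (eqP (E t)) ffunE.
  by apply/forallP => t; rewrite ffunE.
rewrite (bigID (mem (fs @: [set: 'S_k]))) /= [X in _ + X]big1 ?addr0; last first.
  move=> j jfs; case: pickP => [s /forallP E|_]; last by rewrite mul0r.
  case/negP: jfs; apply/imsetP; exists s; rewrite ?finset.in_setT //.
  by apply/ffunP => t; rewrite (eqP (E t)) ffunE.
rewrite big_imset /=; last by move=> s s' _ _; exact: fs_inj.
apply: eq_big => [s|s _]; rewrite ?finset.in_setT // pickE; congr (_ * _).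
by apply: eq_bigr => t _; rewrite mxE ffunE.
Qed.

Lemma dSk_cofactor (k : nat) (a b : 'I_n) A :
  dSk k a b A = (k`!%:R)^-1 * \sum_(f : {ffun 'I_k -> 'I_n}) \sum_p \sum_q
     delta_mx a b (f p) (f q) * cofactor (mxsub f f A) p q.
Proof.
rewrite /dSk (funext (Sk_det k)).
have dsum := is_derive_bigsum (index_enum _) A (delta_mx a b) _ _
  (fun f : {ffun 'I_k -> 'I_n} => is_derive_det_mxsub f A (delta_mx a b)).
exact: (@derive_val _ _ _ _ _ _ _ (is_deriveZ (k`!%:R)^-1 dsum)).
Qed.

Lemma invr_factS (k : nat) :
  (k.+1`!%:R)^-1 *+ k.+1 = (k`!%:R)^-1 :> R.
Proof. by rewrite factS natrM invfM -[LHS]mulr_natl mulVKf // pnatr_eq0. Qed.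

Lemma dSkS_cofactor (k : nat) (a b : 'I_n) A :
  dSk k.+1 a b A = (k`!%:R)^-1 * \sum_(f : {ffun 'I_k.+1 -> 'I_n}) \sum_q
     delta_mx a b (f ord0) (f q) * cofactor (mxsub f f A) ord0 q.
Proof.
by rewrite dSk_cofactor sum_cofactor_row0 mulrnAr -mulrnAl invr_factS.
Qed.

End DerivativeSk.

(** * Assembling the recursion *)

Theorem proposition2p2 (R : realType) (n k : nat) (hn : (1 <= n)%N)
    (hk : (k < n)%N) (A : 'M[R]_n) (i j : 'I_n) :
  dSk k.+1 i j A =
    Sk k A * (i == j)%:R - \sum_(l < n) dSk k i l A * A j l.
Proof.
rewrite dSkS_cofactor sum_delta_cofactor mulrDr mulrA -Sk_det; congr (_ + _).
(* Position 1 exists only for positive [k]; for [k = 0] both sides vanish as empty sums. *)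
case: k {hk} => [|k].
  rewrite big1 => [|f _]; last by rewrite big_ord0.
  rewrite big1 ?oppr0 ?mulr0 // => l _.
  by rewrite dSk_cofactor big1 ?mulr0 ?mul0r // => f _; rewrite big_ord0.
under [in RHS]eq_bigr do rewrite dSkS_cofactor -mulrA.
rewrite -mulr_sumr sum_delta_cofactor_row sum_cofactor_entry01.
(* The multiplicity [k.+1] of the choices of [q] turns $1/(k+1)!$ into the $1/k!$ of the other
   side. *)
by rewrite sum_delta_cofactor01 mulrnAr -mulrnAl invr_factS mulrN.
Qed.
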